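(* Let $\gamma>0$, and let $\mathcal{U}(x)=\{z:\|x-z\|_2\le 1\}$ and $\mathcal{V}(x)=\{z:\|x-z\|_2\le 1+\gamma\}$. Let $\mathcal{H}$ be the set of all half-spaces in $\mathbb{R}^2$. Then $\mathcal{H}$ is $\left(O(1/\epsilon^2),\,O\left(\frac{1}{\sqrt{\gamma}\,\epsilon^2}\right)\right)$ tolerantly certifiable with respect to $\mathcal{U}$ and $\mathcal{V}$, i.e. it admits tolerant $(m,q)$ blackbox query certification with $m=O(1/\epsilon^2)$ and $q=O\left(\frac{1}{\sqrt{\gamma}\,\epsilon^2}\right)$.
   Context: Here $X=\mathbb{R}^2$ and $Y=\{0,1\}$; a half-space is identified with its indicator function $X\to Y$. For a distribution $P$ over $X\times Y$, $P_X$ denotes the marginal of $P$ over $X$, and for $\mathcal{W}\in\{\mathcal{U},\mathcal{V}\}$ the robust loss is $\mathcal{L}^{\mathcal{W}}_P(h)=\Pr_{(x,y)\sim P}[\exists z\in\mathcal{W}(x): h(z)\neq y]$. A label query oracle $\mathcal{O}_h$ for a hypothesis $h$ returns $h(x)$ upon querying $x$, for all $x\in X$. A query-based algorithm is an algorithm $\mathcal{A}:(\bigcup_{i=1}^{\infty}X^i,\mathcal{O}_h)\to\mathbb{R}$, that is, it takes a finite sequence $S$ of (unlabeled) domain points, has access to a label query oracle $\mathcal{O}_h$, and outputs a real number $\mathcal{A}(S,\mathcal{O}_h)$. $\mathcal{U}$ is a restriction of $\mathcal{V}$ if $\mathcal{U}(x)\subseteq\mathcal{V}(x)$ for all $x\in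 X$. A class $\mathcal{H}$ is tolerantly certifiable with respect to $\mathcal{U}$ and $\mathcal{V}$, where $\mathcal{U}$ is a restriction of $\mathcal{V}$, if there exist a query-based algorithm $\mathcal{A}$ and functions $q,m:(0,1)^2\to\mathbb{N}$ such that for every $\epsilon,\delta\in(0,1)$, every distribution $P$ over $X\times Y$, and every $h\in\mathcal{H}$, with probability at least $1-\delta$ over an i.i.d. sample $S\sim P_X^m$ of size $m\ge m(\epsilon,\delta)$ we have $\mathcal{A}(S,\mathcal{O}_h)\in[\mathcal{L}^{\mathcal{U}}_P(h)-\epsilon,\ \mathcal{L}^{\mathcal{V}}_P(h)+\epsilon]$, with a query budget of $q(\epsilon,\delta)$ for $\mathcal{A}$. In this case $\mathcal{H}$ is said to admit tolerant $(m,q)$ blackbox query certification.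
   Formalization: As unlabeled samples cannot determine the loss for arbitrary P, it is proved for labeled samples S~P^m with any P, and for S~P_X^m when y=h(x) almost surely; the budget q(ε,δ) is for samples of size exactly m(ε,δ); constants depend on δ and, for q, on an upper bound for γ. *)

(* Defs.v *)
From HB Require Import structures.
From mathcomp Require Import all_boot all_order all_algebra.
From mathcomp Require Import all_classical all_reals all_analysis.

Set Implicit Arguments.
Unset Strict Implicit.
Unset Printing Implicit Defensive.

Import Order.TTheory GRing.Theory Num.Theory.

Local Open Scope classical_set_scope.
Local Open Scope ring_scope.

Section iid.
Context d (T : measurableType d) (R : realType).

Definition cons_tuple n (p : T * n.-tuple T) : n.+1.-tuple T :=
  [tuple of p.1 :: p.2].

Lemma measurable_cons_tuple n : measurable_fun setT (@cons_tuple n).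
Proof. exact: measurable_cons. Qed.

HB.instance Definition _ n :=
  isMeasurableFun.Build _ _ _ _ (@cons_tuple n) (@measurable_cons_tuple n).

(* The n-fold product P^n, i.e. the law of an i.i.d. sample of size n from P;
   see [iid_lawE]. *)
Fixpoint iid_law (P : probability T R) (n : nat) : probability (n.-tuple T) R :=
  match n with
  | 0 => \d_([tuple] : 0.-tuple T)
  | n'.+1 => distribution (P \x iid_law P n')%E (@cons_tuple n')
  end.

Lemma iid_lawE (P : probability T R) n (A : 'I_n -> set T) :
  (forall i, measurable (A i)) ->
  iid_law P n [set s | forall i, A i (tnth s i)]
  = (\big[mule/1]_(i < n) P (A i))%E.
Proof.
elim: n A => [|n IH] A mA.
  rewrite big_ord0 /= diracE mem_set//=.
  by case.
rewrite big_ord_recl /=.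
transitivity ((P \x iid_law P n)%E
    (A ord0 `*` [set s | forall i, A (lift ord0 i) (tnth s i)])).
  rewrite /distribution /pushforward; congr (_ _).
  apply/seteqP; split => -[x s] /=.
    move=> h; split; first exact: (h ord0).
    by move=> i; have := h (lift ord0 i); rewrite tnthS.
  move=> [h0 h] i; have [j ->|->] := unliftP ord0 i; first by rewrite tnthS.
  exact: h0.
rewrite product_measure1E//.
  by congr (_ * _)%E; apply: IH => i; exact: mA.
rewrite [X in measurable X](_ : _ =
  \bigcap_(i in [set: 'I_n]) ((@tnth n T ^~ i) @^-1` A (lift ord0 i))).
  apply: fin_bigcap_measurable => // i _.
  by rewrite -[X in measurable X]setTI; apply: measurable_tnth.
by apply/seteqP; split => s /= h i; [move=> _|]; exact: h.
Qed.

(* [E] need not be measurable: inner probability. *)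
Definition holds_with_prob (Q : probability T R) (p : R) (E : set T) :=
  exists2 F : set T, measurable F /\ F `<=` E & (p%:E <= Q F)%E.

End iid.

(* One run of a deterministic adaptive algorithm with access to a label oracle
   for a hypothesis X -> bool: output a number, or query a point and continue
   according to the answer. *)
Inductive query_alg (X R : Type) : Type :=
| Output of R
| Query of X & (bool -> query_alg X R).

Section query_algorithms.
Variables X R : Type.

Fixpoint run (h : X -> bool) (a : query_alg X R) : R :=
  match a with
  | Output r => r
  | Query x k => run h (k (h x))
  end.

Fixpoint nb_queries (h : X -> bool) (a : query_alg X R) : nat :=
  match a with
  | Output _ => 0
  | Query x k => (nb_queries h (k (h x))).+1
  end.

End query_algorithms.

Section certification.
Context d (X : measurableType d) (R : realType).
Implicit Types (U V : X -> set X) (h : X -> bool).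
Implicit Types (P : probability (X * bool)%type R).

HB.instance Definition _ :=
  isMeasurableFun.Build _ _ _ _ (@idfun (X * bool)%type) (@measurable_id _ _ setT).
HB.instance Definition _ :=
  isMeasurableFun.Build _ _ _ _ (@fst X bool) measurable_fst.

Definition restriction U V := forall x, U x `<=` V x.

Definition robust_loss U P h : R :=
  fine (P [set xy | exists2 z, U xy.1 z & h z != xy.2]).

(* The algorithm receives the image of an i.i.d. sample under [view], and only
   the pairs (h, P) in [dom] are considered.  It is not told eps and delta; the
   query budget [q eps delta] goes with the sample size [m eps delta], and the
   accuracy guarantee with every sample size from [m eps delta] on. *)
Definition tolerant_certification d' (Z : measurableType d')
    (view : {mfun (X * bool)%type >-> Z})
    (dom : (X -> bool) -> probability (X * bool)%type R -> Prop)
    U V (H : set (X -> bool)) (m q : R -> R -> nat) :=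
  restriction U V /\
  exists A : seq Z -> query_alg X R,
  forall eps delta : R, 0 < eps < 1 -> 0 < delta < 1 ->
  forall h, H h ->
    (forall S : seq Z, size S = m eps delta ->
      (nb_queries h (A S) <= q eps delta)%N) /\
    (forall P, dom h P ->
     forall n, (m eps delta <= n)%N ->
      holds_with_prob (iid_law (distribution P view) n) (1 - delta)
        [set S | robust_loss U P h - eps <= run h (A S)
                                         <= robust_loss V P h + eps]).

(* A certifier that sees no labels y cannot separate two distributions with the
   same marginal on X, whereas their robust losses may be 0 and 1.  So either
   the sample is labelled and P is arbitrary ... *)
Definition labelled_certification :=
  tolerant_certification (@idfun (X * bool)%type) (fun _ _ => True).

(* ... or the sample is drawn from the marginal P_X and P is labelled by h. *)
Definition unlabelled_certification :=
  tolerant_certification (@fst X bool)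
    (fun h P => P [set xy | h xy.1 != xy.2] = 0%E).

End certification.

Section plane.
Variable R : realType.

(* R * R and not 'rV[R]_2 because of its Borel sigma-algebra. *)
Definition plane := (R * R)%type.

Definition eball (r : R) (x : plane) : set plane :=
  [set z | Num.sqrt ((x.1 - z.1) ^+ 2 + (x.2 - z.2) ^+ 2) <= r].

(* closed and open half-spaces *)
Definition halfspaces : set (plane -> bool) :=
  [set h | exists (w : plane) (b : R), w != (0, 0) /\
     ((forall z, h z = (0 <= w.1 * z.1 + w.2 * z.2 + b)) \/
      (forall z, h z = (0 < w.1 * z.1 + w.2 * z.2 + b)))].

End plane.

(* Main.v *)
Require Import Defs.
From HB Require Import structures.
From mathcomp Require Import all_boot all_order all_algebra.
From mathcomp Require Import all_classical all_reals all_analysis.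
From mathcomp Require Import measurable_realfun ring lra.

(* The ball B(x, 1) lies in the convex hull of O(1 / sqrt gamma) points of
   B(x, 1 + gamma).  A half-space and its complement are convex, so if h takes
   the value y at all these points, it does so on B(x, 1): querying them decides
   a loss that lies between the robust 0-1 losses for the two radii.  Its mean
   over an i.i.d. sample concentrates by Chebyshev's inequality.  Only the
   number of bad sample points matters, and its law is computed by conditioning
   on the first point, without integrals over the sample space. *)

Import Order.TTheory GRing.Theory Num.Theory.

Local Open Scope classical_set_scope.
Local Open Scope ring_scope.

(** * Law of a count over an i.i.d. sample, and Chebyshev's inequality *)

Section count_law.
Context {d} {T : measurableType d} {R : realType}.

(** Induction on [n], splitting on whether the first entry satisfies [a]. [B] is arbitrary because a
    success there replaces it by its shift. *)
Lemma measurable_count (a : T -> bool) (B : nat -> bool) n :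
  measurable [set x | a x] ->
  measurable [set s : n.-tuple T | B (count a s)].
Proof.
move=> ma; elim: n B => [|n IHn] B.
  rewrite (_ : [set _ | _] = if B 0%N then setT else set0); first by case: ifP.
  by apply/seteqP; split=> s; rewrite /= (tuple0 s) /=; case: (B 0%N).
pose hd := @tnth n.+1 T ^~ ord0.
pose tl (s : n.+1.-tuple T) := [tuple of behead s] : n.-tuple T.
have hdE x (s : n.-tuple T) : hd [tuple of x :: s] = x by rewrite /hd tnth0.
have mhd D : measurable D -> measurable (hd @^-1` D).
  by move=> mD; rewrite -[X in measurable X]setTI; apply: measurable_tnth.
have mtl D : measurable D -> measurable (tl @^-1` D).
  by move=> mD; rewrite -[X in measurable X]setTI; apply: measurable_behead.
rewrite (_ : [set _ | _] =
    (hd @^-1` [set x | a x] `&` tl @^-1` [set s | B (count a s).+1]) `|`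
    (hd @^-1` (~` [set x | a x]) `&` tl @^-1` [set s | B (count a s)])).
  apply: measurableU; apply: measurableI; first exact: mhd.
  - exact: mtl (IHn (fun k => B k.+1)).
  - by apply: mhd; exact: measurableC.
  - exact: mtl (IHn B).
apply/seteqP; split=> s; case/tupleP: s => x s /=;
  rewrite hdE; case: (boolP (a x)) => /= ax.
- by left.
- by right; split=> //; apply/negP.
- by case=> -[].
- by case=> -[].
Qed.

(* Expectation of [g] under the binomial law B(n, p), by conditioning on the
   first trial. *)
Fixpoint binomial_mean (p : R) (n : nat) (g : nat -> R) : R :=
  match n with
  | 0 => g 0%N
  | n'.+1 => p * binomial_mean p n' (fun k => g k.+1)
             + (1 - p) * binomial_mean p n' g
  end.

(** The event is a disjoint union of two rectangles, according to the first point; their product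
    measures reproduce the recursion of [binomial_mean]. *)
Lemma iid_law_count (P : probability T R) (a : T -> bool) n (B : nat -> bool) :
  measurable [set x | a x] ->
  iid_law P n [set s | B (count a s)]
  = (binomial_mean (fine (P [set x | a x])) n (fun k => (B k)%:R))%:E.
Proof.
move=> ma; set p := fine _.
have Pa : P [set x | a x] = p%:E by rewrite fineK// fin_num_measure.
have PaC : P (~` [set x | a x]) = (1 - p)%:E by rewrite probability_setC// Pa.
elim: n B => [|n IHn] B /=.
  rewrite diracE; case: (boolP (B 0%N)) => B0; first by rewrite mem_set.
  by rewrite memNset//=; exact/negP.
rewrite /distribution /pushforward.
rewrite (_ : _ @^-1` _ =
    ([set x | a x] `*` [set s : n.-tuple T | B (count a s).+1]) `|`
    (~` [set x | a x] `*` [set s : n.-tuple T | B (count a s)])); last first.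
  apply/seteqP; split=> -[x s] /=; case: (boolP (a x)) => /= ax.
  - by left.
  - by right; split=> //; apply/negP.
  - by case=> -[].
  - by case=> -[].
have mS := @measurable_count a (fun k => B k.+1) n ma.
have mB := @measurable_count a B n ma.
have maC := measurableC ma.
transitivity (P [set x | a x] * iid_law P n [set s | B (count a s).+1] +
    P (~` [set x | a x]) * iid_law P n [set s | B (count a s)])%E; last first.
  by rewrite Pa PaC (IHn (fun k => B k.+1)) IHn -!EFinM -EFinD.
rewrite measureU; first last.
- by apply/seteqP; split=> // -[x s] /= [[ax _] [nax _]].
- exact: measurableX.
- exact: measurableX.
by congr (_ + _)%E; exact: product_measure1E.
Qed.

Lemma le_binomial_mean (p : R) n (f g : nat -> R) : 0 <= p <= 1 ->
  (forall k, f k <= g k) -> binomial_mean p n f <= binomial_mean p n g.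
Proof.
move=> /andP[p0 p1]; elim: n f g => [|n IHn] f g fg /=; first exact: fg.
by apply: lerD; apply: ler_wpM2l; rewrite ?subr_ge0//; exact: IHn.
Qed.

Lemma binomial_mean_scale (p c : R) n (g : nat -> R) :
  binomial_mean p n (fun k => c * g k) = c * binomial_mean p n g.
Proof.
elim: n g => //= n IHn g.
by rewrite (IHn (fun k => g k.+1)) IHn; ring.
Qed.

(** Variance plus squared bias. The centre [c] is free because a success in the first trial moves it
    to [c - 1]. *)
Lemma binomial_mean_sqr_dist (p c : R) n :
  binomial_mean p n (fun k => (k%:R - c) ^+ 2)
  = n%:R * (p * (1 - p)) + (n%:R * p - c) ^+ 2.
Proof.
elim: n c => [|n IHn] c /=; first by ring.
rewrite (_ : (fun k => (k.+1%:R - c) ^+ 2) = fun k => (k%:R - (c - 1)) ^+ 2).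
  by rewrite !IHn -natr1; ring.
by apply/funext => k; rewrite -natr1; congr (_ ^+ 2); ring.
Qed.

Lemma iid_law_chebyshev (P : probability T R) (a : T -> bool) n (eps : R) :
  measurable [set x | a x] -> (0 < n)%N -> 0 < eps ->
  (iid_law P n [set s | (eps < `| (count a s)%:R / n%:R
                               - fine (P [set x | a x])|)%R]
   <= ((n%:R * eps ^+ 2)^-1)%:E)%E.
Proof.
move=> ma n0 e0; set p := fine _.
have p01 : 0 <= p <= 1.
  rewrite /p fine_ge0//= -lee_fin fineK ?fin_num_measure//.
  exact: probability_le1.
have nR : 0 < n%:R :> R by rewrite ltr0n.
rewrite (iid_law_count P a n (fun k => eps < `|k%:R / n%:R - p|))// lee_fin.
(* Markov's inequality for the squared deviation: with this factor, the scaled square is at least 1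
   whenever [k / n] is more than [eps] away from [p]. *)
pose c := ((n%:R * eps) ^+ 2)^-1.
have c0 : 0 < c by rewrite invr_gt0 exprn_gt0// mulr_gt0.
apply: (@le_trans _ _
    (binomial_mean p n (fun k => c * (k%:R - n%:R * p) ^+ 2))).
  apply: le_binomial_mean => // k; case: ltP => h /=; last first.
    by rewrite mulr_ge0// ?sqr_ge0// ltW.
  rewrite /c mulrC ler_pdivlMr ?exprn_gt0 ?mulr_gt0// mul1r.
  rewrite (_ : k%:R - n%:R * p = n%:R * (k%:R / n%:R - p)); last first.
    by rewrite mulrBr mulrCA divff ?mulr1// gt_eqF.
  rewrite !exprMn ler_wpM2l ?sqr_ge0//.
  rewrite -(real_normK (num_real (_ - p))) ler_pXn2r ?nnegrE ?normr_ge0//.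
    exact: ltW.
  exact: ltW.
rewrite binomial_mean_scale binomial_mean_sqr_dist subrr expr0n addr0.
rewrite (_ : c * _ = (n%:R * eps ^+ 2)^-1 * (p * (1 - p))); last first.
  by rewrite /c; field; rewrite !gt_eqF.
rewrite -[leRHS]mulr1 ler_wpM2l ?invr_ge0 ?mulr_ge0 ?sqr_ge0 ?ltW//.
by case/andP: p01 => p0 p1; nra.
Qed.

End count_law.

(** * Query algorithms that average a test over the sample *)

Section test_averaging.
Context {X Z : Type} {R : realType}.

Fixpoint ask (xs : seq X) (k : seq bool -> query_alg X R) : query_alg X R :=
  match xs with
  | [::] => k [::]
  | x :: xs' => Query x (fun b => ask xs' (fun bs => k (b :: bs)))
  end.

Lemma run_ask (h : X -> bool) xs k : run h (ask xs k) = run h (k (map h xs)).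
Proof. by elim: xs k => //= x xs IHxs k; rewrite IHxs. Qed.

Lemma nb_queries_ask (h : X -> bool) xs k :
  nb_queries h (ask xs k) = (size xs + nb_queries h (k (map h xs)))%N.
Proof. by elim: xs k => //= x xs IHxs k; rewrite IHxs. Qed.

Variables (pts : Z -> seq X) (test : Z -> seq bool -> bool).

(** [c] accumulates the positive tests; the divisor [n] is fixed at the start, since the recursion
    shortens [S]. *)
Fixpoint test_average (n c : nat) (S : seq Z) : query_alg X R :=
  match S with
  | [::] => Output X (c%:R / n%:R)
  | z :: S' => ask (pts z) (fun bs => test_average n (test z bs + c) S')
  end.

Lemma run_test_average (h : X -> bool) n c S :
  run h (test_average n c S)
  = (count (fun z => test z (map h (pts z))) S + c)%:R / n%:R.
Proof. by elim: S c => //= z S IHS c; rewrite run_ask IHS addnCA addnA. Qed.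

Lemma nb_queries_test_average (h : X -> bool) n c S K :
  (forall z, size (pts z) <= K)%N ->
  (nb_queries h (test_average n c S) <= size S * K)%N.
Proof.
move=> ptsK; elim: S c => //= z S IHS c.
by rewrite nb_queries_ask mulSn leq_add.
Qed.

End test_averaging.

(** From [1 / (delta * eps ^+ 2)] on, Chebyshev's bound is at most [delta]; the successor rounds up
    and keeps the size positive. *)
Definition sample_size {R : realType} (eps delta : R) : nat :=
  (Num.truncn (delta * eps ^+ 2)^-1).+1.

(** Separates probability from geometry: it remains to find a test with at most [K] queries whose
    mean lies between the two robust losses, because the sample mean is within [eps] of that mean
    with probability at least [1 - delta]. *)
Lemma tolerant_certification_of_test d (X : measurableType d) (R : realType)
    d' (Z : measurableType d') (view : {mfun (X * bool)%type >-> Z})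
    (dom : (X -> bool) -> probability (X * bool)%type R -> Prop)
    (U V : X -> set X) (H : set (X -> bool))
    (pts : Z -> seq X) (test : Z -> seq bool -> bool) (K : nat) :
  restriction U V ->
  (forall z, size (pts z) <= K)%N ->
  (forall h, H h -> measurable [set z | test z (map h (pts z))]) ->
  (forall h P, H h -> dom h P ->
     robust_loss U P h
       <= fine (P [set xy | test (view xy) (map h (pts (view xy)))])
       <= robust_loss V P h) ->
  tolerant_certification view dom U V H sample_size
    (fun eps delta => sample_size eps delta * K)%N.
Proof.
move=> UV ptsK mtest loss; split=> //.
(* Dividing by the actual size of [S] makes the algorithm independent of [eps] and [delta], and
   valid for all larger samples. *)
exists (fun S => test_average pts test (size S) 0 S) => eps delta.
move=> /andP[e0 e1] /andP[d0 d1] h Hh; split=> [S sS|P domP n len].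
  by rewrite -sS nb_queries_test_average.
have {loss}/andP[Ul lV] := loss h P Hh domP.
pose a z := test z (map h (pts z)); set Q := distribution P view.
have ma : measurable [set z | a z] := mtest h Hh.
have n0 : (0 < n)%N by rewrite (leq_trans _ len).
pose far := [set S : n.-tuple Z |
  (eps < `|(count a S)%:R / n%:R - fine (Q [set z | a z])|)%R].
have mfar : measurable far.
  exact: (measurable_count a (fun k =>
    (eps < `|k%:R / n%:R - fine (Q [set z | a z])|)%R) n ma).
exists (~` far); first split; first exact: measurableC.
  move=> S /negP; rewrite -leNgt => near.
  rewrite /= run_test_average size_tuple addn0.
  move: near; rewrite ler_norml lerBrDr lerBlDr => /andP[lo hi].
  apply/andP; split; [apply: le_trans lo|apply: (le_trans hi)].
    by rewrite addrC lerD2l.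
  by rewrite addrC lerD2r.
rewrite probability_setC// EFinB leeB//.
apply: (le_trans (iid_law_chebyshev Q a n eps ma n0 e0)).
rewrite lee_fin invf_ple ?posrE ?mulr_gt0 ?exprn_gt0 ?ltr0n//.
rewrite -ler_pdivrMr ?exprn_gt0// -invfM.
apply: (@le_trans _ _ (sample_size eps delta)%:R); last by rewrite ler_nat.
exact/ltW/truncnS_gt.
Qed.

(** * Half-planes, balls and finite sets of translates *)

Section halfplanes.
Context {R : realType}.
Notation plane := (plane R).
Implicit Types (h : plane -> bool) (w x z u v : plane) (r : R).

Definition dot w u : R := w.1 * u.1 + w.2 * u.2.
Definition enorm u : R := Num.sqrt (u.1 ^+ 2 + u.2 ^+ 2).

Lemma sqr_enorm u : enorm u ^+ 2 = u.1 ^+ 2 + u.2 ^+ 2.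
Proof. by rewrite sqr_sqrtr// addr_ge0// sqr_ge0. Qed.

Lemma enorm_gt0 w : w != (0, 0) -> 0 < enorm w.
Proof.
move: w => [a b]; rewrite xpair_eqE negb_and sqrtr_gt0 /= => /orP[] h.
  by rewrite ltr_pwDl ?sqr_ge0// lt_neqAle sqr_ge0 andbT eq_sym sqrf_eq0.
by rewrite ltr_wpDl ?sqr_ge0// lt_neqAle sqr_ge0 andbT eq_sym sqrf_eq0.
Qed.

Lemma enormN u : enorm (- u) = enorm u.
Proof. by rewrite /enorm /= !sqrrN. Qed.

Lemma dotNl w u : dot (- w) u = - dot w u.
Proof. by rewrite /dot /=; ring. Qed.

Lemma dotDr w u v : dot w (u + v) = dot w u + dot w v.
Proof. by rewrite /dot /=; ring. Qed.

(** Cauchy-Schwarz by Lagrange's identity: the difference of the squares is the square of a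
    determinant. *)
Lemma dot_le_enorm w u : dot w u <= enorm w * enorm u.
Proof.
have [|d0] := lerP (dot w u) 0.
  by move/le_trans; apply; rewrite mulr_ge0 ?sqrtr_ge0.
rewrite -(@ler_pXn2r _ 2) ?nnegrE ?mulr_ge0 ?sqrtr_ge0 ?(ltW d0)//.
rewrite exprMn !sqr_enorm -subr_ge0.
rewrite (_ : _ - _ = (w.1 * u.2 - w.2 * u.1) ^+ 2) ?sqr_ge0//.
by rewrite /dot; ring.
Qed.

Lemma eballE r x u : eball r x (x + u) <-> enorm u <= r.
Proof.
have E1 : x.1 - (x + u).1 = - u.1 by rewrite /= opprD addrA subrr sub0r.
have E2 : x.2 - (x + u).2 = - u.2 by rewrite /= opprD addrA subrr sub0r.
by rewrite /eball /mkset E1 E2 !sqrrN.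
Qed.

(** Finite stand-in for the event of a robust loss; for [[:: 0]] it is the ordinary error event. *)
Definition defects h (vs : seq plane) : set (plane * bool) :=
  [set xy | has (fun v => h (xy.1 + v) != xy.2) vs].

Lemma measurable_translate v : measurable_fun setT (fun x => x + v : plane).
Proof.
apply/measurable_fun_pairP; split.
  by apply: (measurable_funD measurable_fst); exact: measurable_cst.
by apply: (measurable_funD measurable_snd); exact: measurable_cst.
Qed.

Lemma measurable_fun_halfspace h : halfspaces h -> measurable_fun setT h.
Proof.
move=> [w [b [_ hE]]].
have mf : measurable_fun setT (fun z : plane => w.1 * z.1 + w.2 * z.2 + b).
  apply: measurable_funD; last exact: measurable_cst.
  apply: measurable_funD; apply: measurable_funM; try exact: measurable_cst.
    exact: measurable_fst.
  exact: measurable_snd.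
case: hE => /funext ->.
  by apply: measurable_fun_ler => //; exact: measurable_cst.
by apply: measurable_fun_ltr => //; exact: measurable_cst.
Qed.

Lemma measurable_defects h vs : measurable_fun setT h ->
  measurable (defects h vs).
Proof.
move=> mh.
suff mf : measurable_fun setT
    (fun xy : plane * bool => has (fun v => h (xy.1 + v) != xy.2) vs).
  by rewrite -[X in measurable X]setTI; exact: (mf _ [set true]).
elim: vs => [|v vs IHvs] /=; first exact: measurable_cst.
apply: measurable_or => //.
have mhv : measurable_fun setT (fun xy : plane * bool => h (xy.1 + v)).
  apply: (measurableT_comp mh).
  exact: (measurableT_comp (measurable_translate v) measurable_fst).
rewrite (_ : (fun _ => _) = fun xy : plane * bool =>
    (h (xy.1 + v) && ~~ xy.2) || (~~ h (xy.1 + v) && xy.2)); last first.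
  by apply/funext => -[x y] /=; case: (h _); case: y.
by apply: measurable_or; apply: measurable_and => //; try exact: measurable_neg;
  try exact: measurable_snd; apply: measurable_neg; exact: measurable_snd.
Qed.

(** Treats open and closed half-spaces alike and eliminates the offset [b]. *)
Lemma halfspace_mono h : halfspaces h -> exists2 w, w != (0, 0) &
  forall z z', dot w z <= dot w z' -> h z -> h z'.
Proof.
move=> [w [b [w0 hE]]]; exists w => // z z'; rewrite /dot => le_zz'.
by case: hE => hE; rewrite !hE => h0; lra.
Qed.

(** By Cauchy-Schwarz, [z] lies between [x + v'] and [x + v] along [w], where [v] and [v'] are the
    two given witnesses. By monotonicity a wrong answer [true] at [z] recurs at [x + v], and a wrong
    answer [false] at [x + v']. *)
Lemma ball_defect h w r vs x y z :
  (forall z z', dot w z <= dot w z' -> h z -> h z') ->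
  (exists2 v, v \in vs & r * enorm w <= dot w v) ->
  (exists2 v, v \in vs & r * enorm w <= dot (- w) v) ->
  eball r x z -> h z != y -> defects h vs (x, y).
Proof.
move=> hmono [v v_vs wv] [v' v'_vs wv'].
have [u ->] : exists u, z = x + u by exists (z - x); rewrite addrC subrK.
move=> /eballE ur hz.
have uw : dot w u <= r * enorm w.
  by rewrite (le_trans (dot_le_enorm w u))// mulrC ler_wpM2r ?sqrtr_ge0.
have uw' : - dot w u <= r * enorm w.
  rewrite -dotNl (le_trans (dot_le_enorm (- w) u))// enormN mulrC.
  by rewrite ler_wpM2r ?sqrtr_ge0.
apply/hasP; case: y hz => hz.
  exists v' => //=; apply: contra hz => /eqP hv'; rewrite (hmono _ _ _ hv')//.
  by rewrite !dotDr lerD2l; move: wv'; rewrite dotNl; lra.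
exists v => //=; move: hz; rewrite !eqbF_neg !negbK; apply: hmono.
by rewrite !dotDr lerD2l (le_trans uw).
Qed.

Lemma defect_ball h r vs x y : (forall v, v \in vs -> enorm v <= r) ->
  defects h vs (x, y) -> exists2 z, eball r x z & h z != y.
Proof. by move=> vsr /hasP[v /vsr/eballE vr hv]; exists (x + v). Qed.

(* A half-space is monotone along its normal [w], so the two extremal points
   x +- r w / |w| of the ball decide. *)
Lemma measurable_ball_defects h r : 0 <= r -> halfspaces h ->
  measurable [set xy : plane * bool | exists2 z, eball r xy.1 z & h z != xy.2].
Proof.
move=> r0 hh; have [w /enorm_gt0 w0 hmono] := halfspace_mono h hh.
pose e : plane := (r / enorm w * w.1, r / enorm w * w.2).
have we : dot w e = r * enorm w.
  rewrite /dot /e /= (mulrCA w.1) (mulrCA w.2) -mulrDr -!expr2 -sqr_enorm.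
  by field; rewrite gt_eqF.
have ne : enorm e = r.
  have e2 : e.1 ^+ 2 + e.2 ^+ 2 = r ^+ 2.
    by rewrite /e /= !exprMn -mulrDr -sqr_enorm; field; rewrite gt_eqF.
  by rewrite /enorm e2 sqrtr_sqr ger0_norm.
rewrite (_ : [set _ | _] = defects h [:: e; - e]).
  by apply: measurable_defects; exact: measurable_fun_halfspace.
apply/seteqP; split=> -[x y] /=.
  move=> [z]; apply: (ball_defect h w r _ x y z hmono).
    by exists e; rewrite ?mem_head// we.
  exists (- e); first by rewrite !inE eqxx orbT.
  by rewrite dotNl /dot /= !mulrN -opprD opprK -we.
by apply: (defect_ball h r) => v; rewrite !inE => /orP[] /eqP->;
  rewrite ?enormN ne.
Qed.

End halfplanes.

(** * Probe points whose convex hull contains the unit ball *)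

Section probes.
Context {R : realType}.
Notation plane := (plane R).
Implicit Types (rho s a b : R) (w v : plane).

(** [(c, e)] is [(1, s)] rescaled to norm [rho]; the list is its orbit under the symmetries of the
    square. *)
Definition probes_at rho s : seq plane :=
  let c := rho / Num.sqrt (1 + s ^+ 2) in let e := c * s in
  [:: (c, e); (c, - e); (- c, e); (- c, - e);
      (e, c); (e, - c); (- e, c); (- e, - c)].

(* Every direction is, up to the symmetries of the square, that of (1, t) with
   t in [0, 1]; the points below have the directions (1, j / n) and their
   images under these symmetries. *)
Definition probes rho (n : nat) : seq plane :=
  0 :: flatten [seq probes_at rho (j%:R / n%:R) | j <- iota 0 n.+1].

Lemma size_probes rho n : size (probes rho n) = (8 * n.+1).+1.
Proof.
rewrite /=; congr S; rewrite !mulnS.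
have -> : forall l : seq nat,
    size (flatten [seq probes_at rho (j%:R / n%:R) | j <- l]) = (8 * size l)%N.
  by elim=> //= j l ->; rewrite mulnS.
by rewrite size_iota.
Qed.

Lemma enorm_probes rho n v : 0 <= rho -> v \in probes rho n -> enorm v <= rho.
Proof.
move=> rho0; rewrite inE => /orP[/eqP->|].
  by rewrite /enorm /= expr0n /= addr0 sqrtr0.
move=> /flatten_mapP[j _]; set s := _ / _.
have s0 : 0 < 1 + s ^+ 2 by rewrite ltr_pwDl// sqr_ge0.
have ce : (rho / Num.sqrt (1 + s ^+ 2)) ^+ 2
    + (rho / Num.sqrt (1 + s ^+ 2) * s) ^+ 2 = rho ^+ 2.
  rewrite !exprMn exprVn sqr_sqrtr ?(ltW s0)//.
  by rewrite -{1}[_ / _]mulr1 -mulrDr divfK ?gt_eqF.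
have ec := ce; rewrite addrC in ec.
rewrite !inE; do 7?[case/orP]; move=> /eqP->;
  by rewrite /enorm /= ?sqrrN ?ce ?ec sqrtr_sqr ger0_norm.
Qed.

(** Rounding the slope [b / a] down to a multiple [s] of [1 / n] costs only a second-order term:
    [(b - a * s) ^+ 2] is at most [a ^+ 2 / n ^+ 2], which the gain [rho ^+ 2 - 1] absorbs. Hence a
    spacing of order [sqrt gamma] suffices. *)
Lemma sector_probe rho n a b : 0 < rho -> (0 < n)%N ->
  n%:R ^- 2 <= rho ^+ 2 - 1 -> 0 <= b <= a ->
  exists2 j, (j <= n)%N & let s := j%:R / n%:R in
    Num.sqrt (a ^+ 2 + b ^+ 2)
    <= rho / Num.sqrt (1 + s ^+ 2) * a + rho / Num.sqrt (1 + s ^+ 2) * s * b.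
Proof.
move=> rho0 n0 hn /andP[b0 ba]; have a0 := le_trans b0 ba.
have nR : 0 < n%:R :> R by rewrite ltr0n.
have [j jn hj] : exists2 j, (j <= n)%N &
    (b - a * (j%:R / n%:R)) ^+ 2 <= a ^+ 2 * n%:R ^- 2.
  have [a_eq0|a_neq0] := eqVneq a 0.
    exists 0%N => //.
    have -> : b = 0 by apply/eqP; rewrite eq_le b0 andbT -a_eq0.
    by rewrite a_eq0 !mul0r subr0 expr0n mul0r.
  have {}a0 : 0 < a by rewrite lt_neqAle eq_sym a_neq0.
  pose t := n%:R * b / a; have t0 : 0 <= t by rewrite divr_ge0 ?mulr_ge0// ltW.
  have /andP[jt tj] := truncn_itv t0; exists (Num.truncn t).
    rewrite -(ler_nat R) (le_trans jt)// /t -mulrA ler_piMr ?(ltW nR)//.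
    by rewrite ler_pdivrMr// mul1r.
  rewrite (_ : b - _ = a / n%:R * (t - (Num.truncn t)%:R)); last first.
    by rewrite /t; field; rewrite !gt_eqF.
  rewrite exprMn -exprVn -[leRHS]exprMn ler_piMr ?sqr_ge0//.
  rewrite expr_le1 ?subr_ge0//.
  by move: tj; rewrite -natr1; lra.
exists j => //=; set s := j%:R / n%:R in hj *.
have s0 : 0 <= s by rewrite divr_ge0// ler0n.
have q0 : 0 < 1 + s ^+ 2 by rewrite ltr_pwDl// sqr_ge0.
set q := Num.sqrt (1 + _); have q_gt0 : 0 < q by rewrite sqrtr_gt0.
have asb : 0 <= a + s * b by rewrite addr_ge0 ?mulr_ge0.
rewrite [leRHS](_ : _ = rho * (a + s * b) / q); last by field; rewrite gt_eqF.
rewrite ler_pdivlMr// -sqrtrM ?addr_ge0 ?sqr_ge0//.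
rewrite -(ger0_norm (mulr_ge0 (ltW rho0) asb)) -sqrtr_sqr ler_sqrt ?sqr_ge0//.
(* Lagrange's identity for [(a, b)] and [(1, s)]. *)
rewrite (_ : _ * (1 + _) = (a + s * b) ^+ 2 + (b - a * s) ^+ 2); last by ring.
rewrite exprMn (_ : rho ^+ 2 * _ =
  (a + s * b) ^+ 2 + (rho ^+ 2 - 1) * (a + s * b) ^+ 2); last by ring.
rewrite lerD2l (le_trans hj)// mulrC ler_pM ?invr_ge0 ?sqr_ge0//.
by rewrite ler_pXn2r ?nnegrE// lerDl mulr_ge0.
Qed.

(** Dual form of the convex hull claim: in each direction [w] the probes reach as far as the unit
    ball. Signs and a swap of coordinates reduce [w] to the sector of [sector_probe]. *)
Lemma probes_cover rho n w : 0 < rho -> (0 < n)%N ->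
  n%:R ^- 2 <= rho ^+ 2 - 1 ->
  exists2 v, v \in probes rho n & enorm w <= dot w v.
Proof.
move=> rho0 n0 hn.
have mem j v : (j <= n)%N -> v \in probes_at rho (j%:R / n%:R) ->
    v \in probes rho n.
  move=> jn hv; rewrite inE; apply/orP; right.
  by apply/flatten_mapP; exists j; rewrite // mem_iota.
have signed x c : exists2 c' : R, (c' == c) || (c' == - c) & x * c' = c * `|x|.
  have [x0|x0] := leP 0 x.
    by exists c; [rewrite eqxx|rewrite ger0_norm// mulrC].
  by exists (- c); [rewrite eqxx orbT|rewrite ltr0_norm//; ring].
have -> : enorm w = Num.sqrt (`|w.1| ^+ 2 + `|w.2| ^+ 2).
  by rewrite !real_normK ?num_real.
have [le21|/ltW le12] := lerP `|w.2| `|w.1|.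
  have [|j jn /=] := sector_probe rho n `|w.1| `|w.2| rho0 n0 hn.
    by rewrite normr_ge0.
  set c := rho / _; set s := _ / _ => hj.
  have [c' hc wc] := signed w.1 c; have [e' he we] := signed w.2 (c * s).
  exists (c', e'); last by rewrite /dot /= wc we.
  apply: (mem j) => //; rewrite !inE !xpair_eqE -/s -/c.
  by case/orP: hc => ->; case/orP: he => ->; rewrite ?orbT.
have [|j jn /=] := sector_probe rho n `|w.2| `|w.1| rho0 n0 hn.
  by rewrite normr_ge0.
set c := rho / _; set s := _ / _ => hj.
have [c' hc wc] := signed w.2 c; have [e' he we] := signed w.1 (c * s).
exists (e', c'); last first.
  by rewrite /dot /= wc we (addrC (`|w.1| ^+ 2)) [leRHS]addrC.
apply: (mem j) => //; rewrite !inE !xpair_eqE -/s -/c.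
by case/orP: hc => ->; case/orP: he => ->; rewrite ?orbT.
Qed.

End probes.

(** The null set [N] will hold the points whose label differs from [h]. *)
Lemma le_fine_prob_null d (T : measurableType d) (R : realType)
    (P : probability T R) (A B N : set T) :
  measurable A -> measurable B -> measurable N -> P N = 0%E ->
  A `<=` B `|` N -> fine (P A) <= fine (P B).
Proof.
move=> mA mB mN PN AB; rewrite fine_le ?fin_num_measure//.
rewrite -[leRHS]adde0 -PN (le_trans (le_measure _ _ _ AB)) ?inE//.
  exact: measurableU.
exact: measureU2.
Qed.

(** * Certification of half-planes by probing *)

Section certification_of_halfplanes.
Context {R : realType} (gamma : R) (gamma_gt0 : 0 < gamma).
Notation plane := (plane R).

(** Chosen so that its inverse square is at most [gamma], hence at most [(1 + gamma) ^+ 2 - 1]. *)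
Definition probe_density : nat := (Num.truncn (Num.sqrt gamma)^-1).+1.
Definition probe_budget : nat := (8 * probe_density.+1).+1.
Notation vs := (probes (1 + gamma) probe_density).

Lemma restriction_eball : restriction (@eball R 1) (eball (1 + gamma)).
Proof. by move=> x z /le_trans; apply; rewrite lerDl ltW. Qed.

Lemma probe_density_large : probe_density%:R ^- 2 <= (1 + gamma) ^+ 2 - 1.
Proof.
apply: (@le_trans _ _ gamma); last first.
  by have := gamma_gt0; have := sqr_ge0 gamma; rewrite sqrrD expr1n mul1r; lra.
rewrite -exprVn -[leRHS](sqr_sqrtr (ltW gamma_gt0)).
rewrite ler_pXn2r ?nnegrE ?invr_ge0 ?ler0n ?sqrtr_ge0//.
rewrite invf_ple ?posrE ?sqrtr_gt0 ?ltr0n//.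
exact/ltW/truncnS_gt.
Qed.

(** Lower bound: the probes reach beyond the unit ball along both [w] and [- w]. Upper bound: each
    probe is itself in the larger ball. *)
Lemma robust_loss_defects (P : probability (plane * bool)%type R) h
    (A N : set (plane * bool)) :
  halfspaces h -> measurable A -> measurable N -> P N = 0%E ->
  (forall xy, ~ N xy -> A xy <-> defects h vs xy) ->
  robust_loss (eball 1) P h <= fine (P A)
    <= robust_loss (eball (1 + gamma)) P h.
Proof.
move=> hh mA mN PN AE.
have gamma1 : 0 < 1 + gamma by rewrite addr_gt0.
have mball r : 0 <= r -> measurable
    [set xy : plane * bool | exists2 z, eball r xy.1 z & h z != xy.2].
  by move=> r0; exact: measurable_ball_defects.
apply/andP; split.
  apply: (@le_fine_prob_null _ _ _ P _ _ N) => //; first exact: mball.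
  move=> xy [z xz hz]; have [Nxy|nNxy] := pselect (N xy); [by right|left].
  apply/(AE _ nNxy); have [w _ hmono] := halfspace_mono h hh.
  rewrite [xy]surjective_pairing.
  apply: (ball_defect h w 1 _ _ _ z hmono _ _ xz hz);
    rewrite mul1r; last rewrite -(enormN w);
    by apply: probes_cover => //; exact: probe_density_large.
apply: (@le_fine_prob_null _ _ _ P _ _ N) => //.
  exact: mball (ltW gamma1).
move=> xy Axy; have [Nxy|nNxy] := pselect (N xy); [by right|left].
move/(AE _ nNxy): Axy; rewrite [xy]surjective_pairing.
by apply: defect_ball => v; apply: enorm_probes; exact: ltW.
Qed.

Lemma size_probe_points (x : plane) :
  (size [seq (x + v)%R | v <- vs] <= probe_budget)%N.
Proof. by rewrite size_map size_probes. Qed.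

Lemma labelled_certification_halfspaces :
  labelled_certification (eball 1) (eball (1 + gamma)) (@halfspaces R)
    (sample_size (R := R))
    (fun eps delta => sample_size eps delta * probe_budget)%N.
Proof.
pose pts (z : plane * bool) := [seq z.1 + v | v <- vs].
pose test (z : plane * bool) bs := has (fun b => b != z.2) bs.
have testE h : [set z | test z (map h (pts z))] = defects h vs.
  by apply/funext => z; rewrite /test /pts /defects /mkset -map_comp has_map.
apply: (tolerant_certification_of_test _ _ _ _ _ _ _ _ _ _ pts test) => /=.
- exact: restriction_eball.
- by move=> z; exact: size_probe_points.
- move=> h hh; rewrite testE.
  by apply: measurable_defects; exact: measurable_fun_halfspace.
- move=> h P hh _; rewrite (testE h).
  apply: (robust_loss_defects _ _ _ set0) => //.
  by apply: measurable_defects; exact: measurable_fun_halfspace.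
Qed.

(* As [probes] starts with 0, the first answer is h x, i.e. the label of x
   almost surely. *)
Lemma unlabelled_certification_halfspaces :
  unlabelled_certification (eball 1) (eball (1 + gamma)) (@halfspaces R)
    (sample_size (R := R))
    (fun eps delta => sample_size eps delta * probe_budget)%N.
Proof.
pose pts (x : plane) := [seq x + v | v <- vs].
(* The default [true] is never returned on actual answers, as [pts x] is nonempty. *)
pose test (x : plane) bs := has (fun b => b != head true bs) bs.
have testE h x : test x (map h (pts x)) <-> defects h vs (x, h x).
  by rewrite /test /pts /defects /mkset -map_comp has_map /= addr0.
have mdefects h : halfspaces h ->
    measurable [set x : plane | defects h vs (x, h x)].
  move=> /measurable_fun_halfspace mh.
  have mp : measurable_fun setT (fun x : plane => (x, h x)).
    exact: measurable_fun_pair.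
  rewrite -[X in measurable X]setTI; apply: mp => //.
  exact: measurable_defects.
apply: (tolerant_certification_of_test _ _ _ _ _ _ _ _ _ _ pts test) => /=.
- exact: restriction_eball.
- by move=> z; exact: size_probe_points.
- move=> h hh; rewrite (_ : [set _ | _] = [set x | defects h vs (x, h x)]).
    exact: mdefects.
  by apply/funext => x; apply/propext; exact: (testE h x).
- move=> h P hh PN.
  have mh := measurable_fun_halfspace h hh.
  apply: (robust_loss_defects _ _ _ [set xy | h xy.1 != xy.2]) => //.
  + rewrite (_ : [set _ | _] = fst @^-1` [set x | defects h vs (x, h x)]).
      rewrite -[X in measurable X]setTI; apply: measurable_fst => //.
      exact: mdefects.
    by apply/funext => xy; apply/propext; exact: (testE h xy.1).
  + have -> : [set xy : plane * bool | h xy.1 != xy.2] = defects h [:: 0].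
      by apply/funext => xy; rewrite /defects /mkset /= addr0 orbF.
    exact: measurable_defects.
  + move=> [x y] /= /negP; rewrite negbK => /eqP <-; exact: (testE h x).
Qed.

End certification_of_halfplanes.

(** * Asymptotic bounds and conclusion *)

Lemma truncnS_le (R : realType) (x : R) : 0 <= x ->
  (Num.truncn x).+1%:R <= x + 1.
Proof. by move=> x0; rewrite -natr1 lerD2r truncn_le. Qed.

(** The 1 lost by rounding up is at most [1 / eps ^+ 2]. *)
Lemma sample_size_le (R : realType) (eps delta : R) :
  0 < eps < 1 -> 0 < delta ->
  (sample_size eps delta)%:R <= (delta^-1 + 1) / eps ^+ 2.
Proof.
move=> /andP[e0 e1] d0.
have e20 : 0 < eps ^+ 2 by rewrite exprn_gt0.
have x0 : 0 <= (delta * eps ^+ 2)^-1 by rewrite invr_ge0 mulr_ge0 ?ltW.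
apply: (le_trans (truncnS_le _ _ x0)).
rewrite mulrDl mul1r (invfM delta) lerD2l -[leLHS]invr1 lef_pV2 ?posrE//.
by rewrite exprn_ile1// ltW.
Qed.

(** The budget is at most [8 / sqrt gamma + 17], and [gamma <= gamma0] lets the constant 17 be
    absorbed into the first term's order. *)
Lemma probe_budget_le (R : realType) (gamma0 gamma : R) :
  0 < gamma <= gamma0 ->
  (probe_budget gamma)%:R <= (8 + 17 * Num.sqrt gamma0) / Num.sqrt gamma.
Proof.
move=> /andP[g0 gg0]; set s := Num.sqrt gamma.
have s0 : 0 < s by rewrite sqrtr_gt0.
have s0_le : s <= Num.sqrt gamma0 by rewrite ler_sqrt// ltW// (lt_le_trans g0).
have : (probe_density gamma)%:R <= s^-1 + 1.
  by rewrite truncnS_le// invr_ge0 ltW.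
have : 1 <= Num.sqrt gamma0 / s by rewrite ler_pdivlMr// mul1r.
have -> : (probe_budget gamma)%:R = 8 * (probe_density gamma)%:R + 9 :> R.
  by rewrite /probe_budget -natr1 natrM -natr1; ring.
move=> h1 h2.
rewrite [leRHS](_ : _ = 8 * s^-1 + 17 * (Num.sqrt gamma0 / s)); last by ring.
lra.
Qed.

Theorem mainTheorem8 (R : realType) :
  exists (m : R -> R -> nat) (q : R -> R -> R -> nat),
  [/\ forall gamma : R, 0 < gamma ->
        labelled_certification (eball 1) (eball (1 + gamma)) (@halfspaces R)
          m (q gamma) /\
        unlabelled_certification (eball 1) (eball (1 + gamma)) (@halfspaces R)
          m (q gamma),
      forall delta : R, 0 < delta < 1 ->
        exists C : R, forall eps : R, 0 < eps < 1 ->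
          (m eps delta)%:R <= C / eps ^+ 2
    & forall gamma0 delta : R, 0 < gamma0 -> 0 < delta < 1 ->
        exists C : R, forall gamma eps : R,
          0 < gamma <= gamma0 -> 0 < eps < 1 ->
          (q gamma eps delta)%:R <= C / (Num.sqrt gamma * eps ^+ 2)].
Proof.
exists sample_size, (fun gamma eps delta =>
  sample_size eps delta * probe_budget gamma)%N.
split=> [gamma gamma_gt0|delta /andP[d0 _]|gamma0 delta _ /andP[d0 _]].
- split; first exact: labelled_certification_halfspaces.
  exact: unlabelled_certification_halfspaces.
- by exists (delta^-1 + 1) => eps eps01; exact: sample_size_le.
exists ((delta^-1 + 1) * (8 + 17 * Num.sqrt gamma0)) => gamma eps g01 eps01.
rewrite natrM invfM [X in _ <= _ * X]mulrC mulrACA.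
by rewrite ler_pM ?ler0n ?sample_size_le ?probe_budget_le.
Qed.
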